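(* Let $\mathscr{H}$ be a complex Hilbert space, let $k,n$ be positive integers, let $T$ be a $k$-quasi $n$-power posinormal bounded linear operator on $\mathscr{H}$, and let $\mathscr{M}$ be a closed $T$-invariant subspace of $\mathscr{H}$. Then the restriction $T|_{\mathscr{M}}$ is also a $k$-quasi $n$-power posinormal operator (on $\mathscr{M}$).
   Context: For a bounded operator $X$, $R(X)$ denotes its range and $X^{*k}=(X^* )^k$. A bounded operator $T$ on a Hilbert space is $k$-quasi $n$-power posinormal if $R(T^{*k}T^n)\subseteq R(T^{*(k+1)})$; equivalently, there is $\lambda>0$ with $T^{*k}(\lambda^2T^*T-T^nT^{*n})T^k\ge 0$. *)

(* Defs.v *)
From HB Require Import structures.
From mathcomp Require Import all_boot all_order all_algebra sesquilinear.
From mathcomp Require Import complex.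
From mathcomp Require Import boolp classical_sets functions reals topology.
From mathcomp Require Import normedtype.

Set Implicit Arguments.
Unset Strict Implicit.
Unset Printing Implicit Defensive.

Import Order.TTheory GRing.Theory Num.Theory Num.Def.
Import numFieldNormedType.Exports.

Local Open Scope classical_set_scope.
Local Open Scope ring_scope.

(* The scalars are [R[i]], the complex numbers over the reals [R].  The inner
   product is linear in its first argument and conjugate-linear in its second. *)
HB.mixin Record isHilbert (R : realType) H & CompleteNormedModule R[i] H := {
  dotp : {dot H for (@conjC R[i])};
  sqr_norm_dotp : forall x : H, `|x| ^+ 2 = dotp x x }.

#[short(type="hilbertType")]
HB.structure Definition Hilbert (R : realType) :=
  {H of isHilbert R H & CompleteNormedModule R[i] H}.

Notation "''[' x , y ]" := (dotp x y) (format "''[' x ,  y ]") : ring_scope.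

Section BoundedOperator.
Variables (R : realType) (H : hilbertType R).

(* Norms take values in [R[i]], where a comparison [a <= b] says that b - a is a
   nonnegative real; so C is a real bound as soon as H is not {0}. *)
Record bounded_operator := BoundedOperator {
  operator :> {linear H -> H};
  operator_bounded : exists C : R[i], forall x, `|operator x| <= C * `|x| }.

(* [adjoint T y] is the vector z representing the functional x |-> '[T x, y];
   it exists when T is bounded (Riesz) and is unique (see [adjoint_eq]). *)
Definition adjoint (T : H -> H) (y : H) : H :=
  get [set z : H | forall x : H, '[T x, y] = '[x, z]].

Lemma adjoint_eq (T : H -> H) (y z : H) :
  (forall x, '[T x, y] = '[x, z]) -> adjoint T y = z.
Proof.
move=> Tyz.
have Tya : forall x, '[T x, y] = '[x, adjoint T y].
  exact: (@getI _ [set u : H | forall x : H, '[T x, y] = '[x, u]] z).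
apply/eqP; rewrite -subr_eq0; apply: contraT => xy.
have := @neq0_dnorm_gt0 _ H _ dotp _ xy.
by rewrite linearBr/= -Tya -Tyz subrr ltxx.
Qed.

Definition quasi_power_posinormal (k n : nat) (T : bounded_operator) : Prop :=
  range (iter k (adjoint T) \o iter n T) `<=` range (iter k.+1 (adjoint T)).

End BoundedOperator.

Record closed_subspace (R : realType) (H : hilbertType R) := ClosedSubspace {
  subspace_set :> set H;
  subspace0 : subspace_set 0;
  subspaceP : forall (a : R[i]) (x y : H),
    subspace_set x -> subspace_set y -> subspace_set (a *: x + y);
  subspace_closed : closed subspace_set }.

Section SubspaceHilbert.
Variables (R : realType) (H : hilbertType R) (M : closed_subspace H).

Definition subspace_pred : {pred H} := mem (M : set H).

Lemma subspace_submod : submod_closed subspace_pred.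
Proof.
split=> [|a x y]; first exact/mem_set/subspace0.
by move=> /set_mem Mx /set_mem My; exact/mem_set/subspaceP.
Qed.

HB.instance Definition _ := GRing.isSubmodClosed.Build _ H subspace_pred
  subspace_submod.

Record subspace_type := SubspaceVec {
  subspace_val : H;
  subspace_valP : subspace_val \in subspace_pred }.

HB.instance Definition _ := [isSub for subspace_val].
HB.instance Definition _ := [Choice of subspace_type by <:].
HB.instance Definition _ := [SubChoice_isSubLmodule of subspace_type by <:].

Lemma subspace_ler_normD (x y : subspace_type) :
  `|subspace_val (x + y)| <= `|subspace_val x| + `|subspace_val y|.
Proof. exact: ler_normD. Qed.

Lemma subspace_normrZ (a : R[i]) (x : subspace_type) :
  `|subspace_val (a *: x)| = `|a| * `|subspace_val x|.
Proof. exact: normrZ. Qed.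

Lemma subspace_normr0_eq0 (x : subspace_type) : `|subspace_val x| = 0 -> x = 0.
Proof. by move/normr0_eq0 => x0; exact: val_inj. Qed.

HB.instance Definition _ := Lmodule_isNormed.Build R[i] subspace_type
  subspace_ler_normD subspace_normrZ subspace_normr0_eq0.

Lemma subspace_complete (F : set_system subspace_type) :
  ProperFilter F -> cauchy F -> cvg F.
Proof.
move=> FF Fc.
have vFc : cauchy (subspace_val @ F).
  apply/cauchy_ballP => e e0; have /cauchy_ballP/(_ e e0) := Fc.
  move=> [[A B]/= [FA FB] AB].
  exists (subspace_val @` A, subspace_val @` B) => /=.
    split; first by apply: filterS FA => x; exists x.
    by apply: filterS FB => x; exists x.
  move=> [_ _] /= [[x Ax <-] [y By <-]].
  rewrite -ball_normE; have := AB (x, y) (conj Ax By).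
  by rewrite -ball_normE.
have vF : cvg (subspace_val @ F) by exact: cauchy_cvg.
have Ml : subspace_pred (lim (subspace_val @ F)).
  apply/mem_set; apply: (closed_cvg _ (@subspace_closed _ _ M) _ _ vF).
  by near=> x; apply: set_mem; exact: subspace_valP.
apply/cvg_ex; exists (SubspaceVec Ml).
apply/cvgrPdist_lt => e e0.
by have /cvgrPdist_lt/(_ e e0) := vF.
Unshelve. all: by end_near. Qed.

HB.instance Definition _ := Uniform_isComplete.Build subspace_type
  subspace_complete.

Definition subspace_dotp (x y : subspace_type) : R[i] :=
  '[subspace_val x, subspace_val y].

Lemma subspace_dotp_bilinear :
  bilinear_for *%R (@conjC R[i] \; *%R) subspace_dotp.
Proof.
by split=> u a x y; rewrite /subspace_dotp/= [LHS](linearPl, linearPr).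
Qed.

HB.instance Definition _ := bilinear_isBilinear.Build R[i] subspace_type
  subspace_type R[i] *%R (@conjC R[i] \; *%R) subspace_dotp
  subspace_dotp_bilinear.

Lemma subspace_dotp_hermitian (x y : subspace_type) :
  subspace_dotp x y = (-1) ^+ false * (subspace_dotp y x)^*.
Proof. exact: (@hermitian_subproof _ _ _ _ dotp). Qed.

HB.instance Definition _ := isHermitianSesquilinear.Build R[i] subspace_type
  false (@conjC R[i]) subspace_dotp subspace_dotp_hermitian.

Lemma subspace_dotp_gt0 (x : subspace_type) : x != 0 -> 0 < subspace_dotp x x.
Proof. by move=> x0; exact: (@neq0_dnorm_gt0 _ H _ dotp). Qed.

HB.instance Definition _ := isDotProduct.Build R[i] subspace_type subspace_dotp
  subspace_dotp_gt0.

Lemma subspace_sqr_norm (x : subspace_type) : `|x| ^+ 2 = subspace_dotp x x.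
Proof. exact: (sqr_norm_dotp (subspace_val x)). Qed.

HB.instance Definition _ := isHilbert.Build R subspace_type
  subspace_sqr_norm.

End SubspaceHilbert.

Definition invariant_subspace (R : realType) (H : hilbertType R)
    (T : bounded_operator H) (M : closed_subspace H) : Prop :=
  T @` M `<=` M.

Section Restriction.
Variables (R : realType) (H : hilbertType R) (M : closed_subspace H).
Variables (T : bounded_operator H) (TM : invariant_subspace T M).

Lemma restriction_subproof (x : subspace_type M) :
  T (subspace_val x) \in subspace_pred M.
Proof.
by apply/mem_set/TM; exists (subspace_val x) => //; exact/set_mem/subspace_valP.
Qed.

Definition restriction_fun (x : subspace_type M) : subspace_type M :=
  SubspaceVec (restriction_subproof x).

Lemma restriction_linear : linear restriction_fun.
Proof. by move=> a x y; apply: val_inj; rewrite /= linearP. Qed.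

HB.instance Definition _ := GRing.isLinear.Build R[i] (subspace_type M)
  (subspace_type M) *:%R restriction_fun restriction_linear.

Lemma restriction_bounded :
  exists C : R[i], forall x, `|restriction_fun x| <= C * `|x|.
Proof. by have [C TC] := operator_bounded T; exists C => x; exact: TC. Qed.

Definition restriction : bounded_operator (subspace_type M) :=
  BoundedOperator restriction_bounded.

End Restriction.

(* Main.v *)
(** The operator [A = T|_M] satisfies [A^* P = P T^*], where [P] is the orthogonal
    projection onto [M], because [M] is [T]-invariant; hence
    [A^*j P = P T^*j] for every [j].  If [T^*k T^n x = T^*(k+1) y] with [x] in [M],
    projecting both sides gives [A^*k A^n x = A^*(k+1) (P y)].

    The existence of adjoints and of [P y] both come from the Riesz
    representation theorem (in [H], resp. in [M]).  For a bounded functional [f],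
    let [J x = |x|^2 - 2 Re (f x)] and [m = inf J].  Minimizing [J] along the line
    through [x] directed by [h] gives [|<h, x> - f h|^2 <= (J x - m) |h|^2], so
    that minimizing sequences are Cauchy and their limit represents [f]. *)

Require Import Defs.
From mathcomp Require Import all_boot all_order all_algebra sesquilinear.
From mathcomp Require Import complex.
From mathcomp Require Import boolp classical_sets reals topology.
From mathcomp Require Import normedtype sequences.
From mathcomp Require Import ring.

Set Implicit Arguments.
Unset Strict Implicit.
Unset Printing Implicit Defensive.

Import Order.TTheory GRing.Theory Num.Theory Num.Def.
Import numFieldNormedType.Exports.

Local Open Scope classical_set_scope.
Local Open Scope ring_scope.

Section Riesz.
Variables (R : realType) (H : hilbertType R).
Implicit Types (f : H -> R[i]) (x y z h : H).

(** The energy of the Riesz argument: [f x + (f x)^*] is 2 Re (f x), written in [R[i]] so that real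
    values need no cast. *)
Let J f x : R[i] := '[x, x] - (f x + (f x)^*).

Lemma dotpC x y : '[x, y] = '[y, x]^*.
Proof. by rewrite (@hermitian_subproof _ _ _ _ dotp) expr0 mul1r. Qed.

Lemma dotp_inj x y : (forall h, '[h, x] = '[h, y]) -> x = y.
Proof.
move=> xy; apply/eqP; rewrite -subr_eq0; apply: contraT => w0.
by have := @neq0_dnorm_gt0 _ H _ dotp _ w0; rewrite linearBr/= xy subrr ltxx.
Qed.

Lemma energy_gap f (m : R[i]) x h : scalar f -> (forall y, m <= J f y) ->
  `|'[h, x] - f h| ^+ 2 <= (J f x - m) * `|h| ^+ 2.
Proof.
move=> flin mJ; have [->|h0] := eqVneq h 0.
  have f0 : f 0 = 0 by have := flin (-1) 0 0; rewrite scaler0 add0r mulN1r addNr.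
  by rewrite f0 linear0l subrr !normr0 !expr0n mulr0.
set d := _ - _; have hh0 : 0 < '[h, h] by exact: neq0_dnorm_gt0.
have sC : ('[h, h]^-1)^* = '[h, h]^-1 by rewrite conj_Creal// rpredV ger0_real ?ltW.
rewrite sqr_norm_dotp -ler_pdivrMr//.
(* This coefficient t minimizes J (t h + x) = J x + 2 Re (t d) + |t|^2 |h|^2; the minimum is J x -
   |d|^2 / |h|^2. *)
have := mJ (- d^* / '[h, h] *: h + x); rewrite -subr_ge0 => Jge.
rewrite -subr_ge0; congr (0 <= _): Jge.
rewrite /J flin linearPl !linearPr/= (dotpC x h) normCK.
rewrite /d !(rmorphD, rmorphM, rmorphN, rmorphB)/= !conjCK ?sC.
field; by rewrite gt_eqF.
Qed.

(** Cauchy-Schwarz is the gap estimate for the zero functional, whose energy |x|^2 is bounded below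
    by 0. *)
Lemma dotp_le_norm h x : `|'[h, x]| <= `|h| * `|x|.
Proof.
rewrite -(@ler_pXn2r _ 2)// ?nnegrE ?mulr_ge0//.
have J0 y : J (fun=> 0) y = `|y| ^+ 2.
  by rewrite /J rmorph0 addr0 subr0 sqr_norm_dotp.
have /(_ x h) := @energy_gap (fun=> 0) 0.
rewrite J0 !subr0 mulrC exprMn; apply=> [a u v|y]; first by rewrite mulr0 addr0.
by rewrite J0 exprn_ge0.
Qed.

Lemma energy_inf f : (exists C, forall x, `|f x| <= C * `|x|) ->
  exists m, (forall x, m <= J f x) /\
    forall e : R[i], 0 < e -> exists x, J f x - m < e.
Proof.
move=> [C fC].
have JE x : (complex.Re (J f x))%:C%C = J f x.
  rewrite RRe_real// rpredB//; first by rewrite -sqr_norm_dotp rpredX// normr_real.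
  by rewrite CrealE rmorphD/= conjCK addrC.
(* When [H] is {0}, [C] may fail to be real; its modulus is a real bound in every case. *)
have fC' x : `|f x| <= `|C| * `|x|.
  by rewrite -[`|x|]normr_id -normrM (le_trans (fC x))//
    real_ler_norm// ger0_real// (le_trans _ (fC x)).
(* Complete the square: |x|^2 - 2 |C| |x| + |C|^2 = (|x| - |C|)^2. *)
have Jlb x : - `|C| ^+ 2 <= J f x.
  have fx : f x + (f x)^* <= `|C| * `|x| + `|C| * `|x|.
    have fR : f x + (f x)^* \is Num.real by rewrite CrealE rmorphD/= conjCK addrC.
    rewrite (le_trans (real_ler_norm fR))// (le_trans (ler_normD _ _))//.
    by rewrite norm_conjC lerD.
  rewrite /J -sqr_norm_dotp (le_trans _ (lerB (lexx _) fx))// -subr_ge0.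
  have CxR : `|x| - `|C| \is Num.real by rewrite rpredB// normr_real.
  by rewrite (_ : _ - _ = (`|x| - `|C|) ^+ 2) ?real_exprn_even_ge0//; ring.
(* Infima exist in [R], so [E] collects real parts; [JE] carries the result back to [R[i]]. *)
pose E := range (fun x => complex.Re (J f x)).
have Einf : has_inf E.
  split; first by exists (complex.Re (J f 0)), 0.
  exists (- (complex.Re `|C|) ^+ 2) => _ [x _ <-].
  have CE : (complex.Re `|C|)%:C%C = `|C| by rewrite RRe_real ?normr_real.
  by rewrite -lecR JE; have := Jlb x; rewrite -{1}CE -rmorphXn -rmorphN.
exists (inf E)%:C%C; split=> [x|e e0].
  by rewrite -JE lecR; apply: ge_inf; [case: Einf|exists x].
have eE : (complex.Re e)%:C%C = e by rewrite RRe_real// gtr0_real.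
have [|_ [x _ <-]] := @inf_adherent _ E (complex.Re e) _ Einf.
  by rewrite -ltcR eE.
by rewrite -ltcR rmorphD/= JE eE -ltrBlDl; exists x.
Qed.

Lemma riesz f : scalar f -> (exists C, forall x, `|f x| <= C * `|x|) ->
  exists z, forall x, f x = '[x, z].
Proof.
move=> flin /energy_inf[m [mJ minf]].
have approx (d : R[i]) : 0 < d ->
    exists z, forall h, `|'[h, z] - f h| <= d * `|h|.
  move=> d0; have [|z Jz] := minf (d ^+ 2); first by rewrite exprn_gt0.
  exists z => h; rewrite -(@ler_pXn2r _ 2)// ?nnegrE ?mulr_ge0 ?(ltW d0)//.
  rewrite (le_trans (energy_gap z h flin mJ))// exprMn ler_wpM2r ?exprn_ge0//.
  exact: ltW.
have /choice[u uf] n : exists z, forall h,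
    `|'[h, z] - f h| <= n.+1%:R^-1 * `|h|.
  by apply: approx; rewrite invr_gt0 ltr0n.
(* With h = u p - u q, the term f h cancels: |h|^2 is the difference of the errors of [u p] and
   [u q] at [h]. Each is at most its rate times |h|; divide by |h|. *)
have udist p q : `|u p - u q| <= p.+1%:R^-1 + q.+1%:R^-1.
  have [/eqP->|] := boolP (`|u p - u q| == 0).
    by rewrite addr_ge0// invr_ge0.
  move=> pq; have pq0 : 0 < `|u p - u q| by rewrite lt_def pq /=.
  rewrite -(ler_pM2r pq0) -expr2 sqr_norm_dotp.
  set h := u p - u q.
  have -> : '[h, h] = ('[h, u p] - f h) - ('[h, u q] - f h).
    by rewrite opprB addrA subrK -linearBr.
  have h2 : 0 <= ('[h, u p] - f h) - ('[h, u q] - f h).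
    by rewrite opprB addrA subrK -linearBr /= -sqr_norm_dotp exprn_ge0.
  by rewrite -(ger0_norm h2) (le_trans (ler_normB _ _))// mulrDl lerD ?uf.
have inv0 (e : R[i]) : 0 < e -> \forall n \near \oo, n.+1%:R^-1 < e.
  move=> e0; have eR : (complex.Re e)%:C%C = e by rewrite RRe_real// gtr0_real.
  have Re0 : 0 < complex.Re e by rewrite -ltcR eR.
  have /cvgr_lt/(_ _ Re0) := @cvg_harmonic R; apply: filterS => n.
  by rewrite -ltcR eR /= fmorphV rmorph_nat.
have /cauchy_cvg/cvg_ex[z uz] : cauchy (u @ \oo).
  apply: cauchy_exP => e e0; have e20 : 0 < e / 2 by rewrite divr_gt0.
  have [N _ Ne] := inv0 _ e20; exists (u N).
  change (\forall n \near \oo, ball (u N) e (u n)).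
  near=> n; rewrite -ball_normE /= (le_lt_trans (udist _ _))// (splitr e).
  by rewrite ltrD//; apply: Ne => /=; [exact: leqnn | near: n; exact: nbhs_infty_ge].
exists z => h; apply/eqP; rewrite eq_sym -subr_eq0 -normr_le0.
apply/ler_addgt0Pr => e e0; rewrite add0r.
(* The limit error and the error of [u n] get e / 2 each; the [+ 1] keeps the divisor positive when
   [h] is zero. *)
have h1 : 0 < `|h| + 1 by rewrite ltr_wpDl.
have d0 : 0 < e / 2 / (`|h| + 1) by rewrite !divr_gt0.
have dh : e / 2 / (`|h| + 1) * `|h| <= e / 2.
  by rewrite mulrAC ler_pdivrMr// ler_wpM2l ?lerDl// divr_ge0// ltW.
near \oo => n.
have zn : `|z - u n| <= e / 2 / (`|h| + 1).
  by apply: ltW; near: n; move/cvgrPdist_lt : uz => /(_ _ d0).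
have nd : n.+1%:R^-1 <= e / 2 / (`|h| + 1).
  by apply: ltW; near: n; exact: inv0.
rewrite -(subrK '[h, u n] '[h, z]) -linearBr -addrA.
rewrite (le_trans (ler_normD _ _))// (splitr e) lerD//.
  by rewrite (le_trans (dotp_le_norm _ _))// (le_trans (ler_wpM2l _ zn))// mulrC.
by rewrite (le_trans (uf _ _))// (le_trans (ler_wpM2r _ nd)).
Unshelve. all: by end_near. Qed.

End Riesz.

Section Adjoint.
Variables (R : realType) (H : hilbertType R) (T : bounded_operator H).

(** Riesz for the functional x |-> <T x, y> makes the set in [adjoint] nonempty, so [get] does not
    return its default. *)
Lemma dotp_adjoint (x y : H) : '[T x, y] = '[x, adjoint T y].
Proof.
have [z Tz] : exists z, forall x, '[T x, y] = '[x, z].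
  apply: riesz => [a u v|]; first by rewrite linearP linearPl.
  have [C TC] := operator_bounded T; exists (C * `|y|) => u.
  by rewrite (le_trans (dotp_le_norm _ _))// mulrAC ler_wpM2r.
by rewrite (adjoint_eq Tz).
Qed.

Lemma dotp_iter_adjoint j (x y : H) :
  '[iter j T x, y] = '[x, iter j (adjoint T) y].
Proof. by elim: j x y => // j IH x y; rewrite iterS dotp_adjoint IH -iterSr. Qed.

End Adjoint.

Section Projection.
Variables (R : realType) (H : hilbertType R) (M : closed_subspace H).

(** Riesz inside [subspace_type M], for the functional <., y> restricted to [M]; [u] is P y. *)
Lemma orthogonal_projection (y : H) : exists u : subspace_type M,
  forall x : subspace_type M, '[subspace_val x, y] = '[x, u].
Proof.
apply: riesz => [a u v|]; first exact: linearPl.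
by exists `|y| => u; rewrite (le_trans (dotp_le_norm _ _))// mulrC.
Qed.

Lemma subspace_val_iter (T : bounded_operator H) (TM : invariant_subspace T M)
    j (x : subspace_type M) :
  subspace_val (iter j (restriction TM) x) = iter j T (subspace_val x).
Proof. by elim: j => // j IH; rewrite !iterS /= IH. Qed.

End Projection.

Theorem proposition2p8 (R : realType) (H : hilbertType R) (k n : nat)
    (k_gt0 : (0 < k)%N) (n_gt0 : (0 < n)%N)
    (T : bounded_operator H) (M : closed_subspace H) (TM : invariant_subspace T M) :
  quasi_power_posinormal k n T ->
  quasi_power_posinormal k n (restriction TM).
Proof.
move=> Tkn _ [x _ <-].
have [y _ Ty] := Tkn _ (ex_intro2 _ _ (subspace_val x) I erefl).
have [u yu] := orthogonal_projection M y.
exists u => //; apply: dotp_inj => w.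
(* Paired with [w] in [M], adjoint powers become powers acting on [w], where [restriction TM] and
   [T] agree; the claim reduces to [Ty] paired with [w]. *)
rewrite -!dotp_iter_adjoint -yu subspace_val_iter dotp_iter_adjoint Ty /=.
by rewrite -dotp_iter_adjoint -!subspace_val_iter.
Qed.
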